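(* Let $\ell\geqslant 1$ be an integer and set $$M=\begin{cases}2, & \ell=1,\\ 8, & \ell=2,\\ 6\ell, & \ell\geqslant 3.\end{cases}$$ Then every regular $2$-dimensional train network with trains of length $\ell$ has a (collision-free) schedule with delay at most $M-1$.
   Context: A ($d$-dimensional) train line consists of: a track, which is a line segment in $\mathbb{R}^d$ with distinct endpoints, one designated the departure point and the other the arrival point; a train length, which is a positive real number; and a speed, which is a positive real number. A train network is a set of train lines whose tracks are pairwise non-overlapping (but possibly crossing). Here two tracks overlap if their intersection contains a non-degenerate segment, and two tracks cross if they are not parallel and have a common point, called their crossing point. For a set $X$ of real numbers and a real number $y$, $X+y=\{x+y : x\in X\}$. A (collision-free) schedule for a train network assigns to each of its lines a delay, which is a non-negative real number, such that for any two lines whose tracks cross, the open intervals $(0,\ell/v)+t+\delta/v$ and $(0,\ell'/v')+t'+\delta'/v'$ do not intersect, where $t,t'$ are the respective delays assigned to the two lines, $\delta,\delta'$ are the respective distances from their departure points to the crossing point, $\ell,\ell'$ are their respective train lengths and $v,v'$ their respective speeds. The delay of a schedule is the maximum delay it assigns (read as a supremum in $[0,\infty]$ if the network is infinite or empty). A $d$-dimensional train network is regular if all its lines have speed $1$, all its lines have the same train length and it is an integer, all its tracks are axis-parallel, and all its departure and arrival points are in $\mathbb{Z}^d$. *)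

(* Defs.v *)
From HB Require Import structures.
From mathcomp Require Import all_boot all_order all_algebra.
From mathcomp Require Import all_classical all_reals.
From mathcomp Require Import ereal.

Set Implicit Arguments.
Unset Strict Implicit.
Unset Printing Implicit Defensive.

Import Order.TTheory GRing.Theory Num.Theory.

Local Open Scope classical_set_scope.
Local Open Scope ring_scope.

(* All side conditions are boolean, so two train lines are equal as soon as
   their endpoints, lengths and speeds are. *)
Record train_line (R : realType) (d : nat) := TrainLine {
  departure : 'rV[R]_d;
  arrival : 'rV[R]_d;
  train_length : R;
  speed : R;
  departure_neq_arrival : departure != arrival;
  train_length_gt0 : 0 < train_length;
  speed_gt0 : 0 < speed
}.

Definition segment (R : realType) (d : nat) (a b : 'rV[R]_d) : set 'rV[R]_d :=
  [set (1 - s) *: a + s *: b | s in `[0, 1]].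

(* The library norm on row vectors is the sup norm, hence this definition. *)
Definition euclidean_dist (R : realType) (d : nat) (x y : 'rV[R]_d) : R :=
  Num.sqrt (\sum_(i < d) (x ord0 i - y ord0 i) ^+ 2).

Section TrainLines.
Context {R : realType} {d : nat}.
Implicit Types (L K : train_line R d) (N : set (train_line R d)).

Definition track L : set 'rV[R]_d := segment (departure L) (arrival L).

Definition overlap L K : Prop :=
  exists a b : 'rV[R]_d, a != b /\ segment a b `<=` track L `&` track K.

(* Direction vectors are nonzero, so this relation is symmetric. *)
Definition parallel L K : Prop :=
  exists c : R, arrival L - departure L = c *: (arrival K - departure K).

(* Non-parallel tracks share at most one point. *)
Definition crossing_point L K (x : 'rV[R]_d) : Prop :=
  ~ parallel L K /\ (track L `&` track K) x.

Definition train_network N : Prop :=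
  forall L K, N L -> N K -> L <> K -> ~ overlap L K.

Definition translate (X : set R) (y : R) : set R := [set x + y | x in X].

(* The set of times during which the train of L, delayed by t, occupies x. *)
Definition occupation L (t : R) (x : 'rV[R]_d) : set R :=
  translate `]0, train_length L / speed L[
    (t + euclidean_dist (departure L) x / speed L).

(* The values of t outside N are irrelevant. *)
Definition schedule N (t : train_line R d -> R) : Prop :=
  (forall L, N L -> 0 <= t L) /\
  (forall L K x, N L -> N K -> crossing_point L K x ->
     occupation L (t L) x `&` occupation K (t K) x = set0).

(* Adjoining 0 makes this the supremum in [0, +oo]: an empty network has
   delay 0, and nothing changes otherwise as delays are nonnegative. *)
Definition delay N (t : train_line R d -> R) : \bar R :=
  ereal_sup (0%E |` [set (t L)%:E | L in N]).

Definition axis_parallel L : Prop :=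
  exists i : 'I_d, forall j : 'I_d, j != i ->
    departure L ord0 j = arrival L ord0 j.

Definition integral_point (x : 'rV[R]_d) : Prop :=
  forall i : 'I_d, x ord0 i \is a Num.int.

Definition trains_of_length N (l : R) : Prop :=
  forall L, N L -> train_length L = l.

Definition regular N : Prop :=
  [/\ forall L, N L -> speed L = 1,
      exists2 l : R, l \is a Num.int & trains_of_length N l,
      forall L, N L -> axis_parallel L
    & forall L, N L ->
        integral_point (departure L) /\ integral_point (arrival L)].

End TrainLines.

Definition M (l : nat) : nat :=
  (if l == 1 then 2 else if l == 2 then 8 else 6 * l)%N.

(* Main.v *)
(** Delaying a train by [t] only matters through its phase: the train occupies
    the point at coordinate [x] of its axis during [(p + s x, p + s x + l)],
    where [s = 1] or [-1] is its direction, [a] the coordinate of its departure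
    point and [p = t - s a].  As integer delays in [0, M) realise every phase
    modulo [M], it is enough to let the phase depend only on the orientation,
    the direction [s] and the transversal coordinate [y] of the line, in such a
    way that [d = (p + s x) - (q + u y)] never lies in [(-l, l)] modulo [M], for
    [p] the phase of the horizontal line at height [y] with direction [s] and
    [q] that of the vertical line at abscissa [x] with direction [u].
    For [l >= 3], take [p = - s y + (2 s y mod 2l)] and
    [q = 3l - u x + (2 u x mod 2l)].  If [s = u], then [p - s y] is a multiple
    of [2l] and [q - u x] an odd multiple of [l], so [d] is an odd multiple of
    [l].  If [s = - u], then [d = (2 s y mod 2l) - (2 u x mod 2l) - 3l] lies in
    [(-5l, -l)].  As only even
    values [2 s y] occur, the modulus [2] suffices for [l = 1]; for [l = 2] and
    the modulus [8], [q] is chosen so that [q - u x = 2] modulo [4] and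
    [q + u x] is [4] or [6]. *)
Require Import Defs.
From mathcomp Require Import all_boot all_order all_algebra.
From mathcomp Require Import all_classical all_reals.
From mathcomp Require Import ereal.
From mathcomp Require Import zify ring lra.

Import Order.TTheory GRing.Theory Num.Theory.
Local Open Scope classical_set_scope.
Local Open Scope ring_scope.

Section PhaseDelay.
Set Implicit Arguments.
Unset Strict Implicit.

Definition phase (l : nat) (horiz : bool) (s y : int) : int :=
  if horiz then - (s * y) + (2 * (s * y) %% (2 * l%:Z))%Z
  else if l == 2 then - (s * y) + 4 + ((2 * (s * y) + 2) %% 4)%Z
  else - (s * y) + 3 * l%:Z + (2 * (s * y) %% (2 * l%:Z))%Z.

Lemma phase_gap (l : nat) (s u x y k : int) : (0 < l)%N ->
  s = 1 \/ s = -1 -> u = 1 \/ u = -1 ->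
  let d := phase l true s y + s * x - (phase l false u x + u * y)
           + k * (M l)%:Z in
  (l%:Z <= d) || (d <= - l%:Z).
Proof.
move=> l_gt0 hs hu /=; rewrite /phase /M.
have [->|l_neq1] := eqVneq l 1%N.
  by case: hs => ->; case: hu => -> /=; lia.
(* For [l = 2], the quantity d is 2 modulo 4 if [s = u], and -6, -4 or -2 modulo 8 if [s = - u]. *)
have [->|l_neq2] := eqVneq l 2%N.
  by case: hs => ->; case: hu => -> /=; lia.
have modE (z : int) : exists q : int,
    [/\ (z %% (2 * l%:Z))%Z = z - q * (2 * l%:Z),
        0 <= z - q * (2 * l%:Z) & z - q * (2 * l%:Z) < 2 * l%:Z].
  exists (z %/ (2 * l%:Z))%Z; rewrite -/(modz z (2 * l%:Z)).
  by split=> //; [apply: modz_ge0 | apply: ltz_pmod]; lia.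
have [q [-> q_ge0 q_lt]] := modE (2 * (s * y)).
have [r [-> r_ge0 r_lt]] := modE (2 * (u * x)).
have odd_multiple (n : int) : (l%:Z <= (2 * n + 1) * l%:Z) ||
    ((2 * n + 1) * l%:Z <= - l%:Z).
  by have [?|?] := leP 0 n; apply/orP; [left|right]; nia.
(* The next translate of (-5l, -l) by the modulus 6l is (l, 5l), so no translate meets [-l, l]. *)
have far (e : int) : - 5 * l%:Z < e < - l%:Z ->
    (l%:Z <= e + k * (6 * l)%N%:Z) || (e + k * (6 * l)%N%:Z <= - l%:Z).
  by move=> ?; have [?|?] := leP 1 k; apply/orP; [left|right]; nia.
case: hs hu q_ge0 q_lt r_ge0 r_lt => -> [] -> q_ge0 q_lt r_ge0 r_lt.
- rewrite (_ : _ + _ = (2 * (r - q - 2 + 3 * k) + 1) * l%:Z) //; nia.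
- apply: far; lia.
- apply: far; lia.
- rewrite (_ : _ + _ = (2 * (r - q - 2 + 3 * k) + 1) * l%:Z) //; nia.
Qed.

Context {R : realType}.
Implicit Types (L K : train_line R 2) (x y : 'rV[R]_2).

Definition horizontal L : bool := departure L ord0 1 == arrival L ord0 1.

Definition along L : 'I_2 := if horizontal L then 0 else 1.
Definition across L : 'I_2 := if horizontal L then 1 else 0.

Definition heading L : int :=
  sgz (arrival L ord0 (along L) - departure L ord0 (along L)).

(** Departure points being integral, [Num.floor] merely casts the coordinate to [int]. *)
Definition origin L : int := Num.floor (departure L ord0 (along L)).
Definition height L : int := Num.floor (departure L ord0 (across L)).

Lemma row2P x y : x ord0 0 = y ord0 0 -> x ord0 1 = y ord0 1 -> x = y.
Proof.
move=> e0 e1; apply/rowP => -[[|[|//]] lt_i].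
  by rewrite (_ : Ordinal lt_i = 0) //; apply: val_inj.
by rewrite (_ : Ordinal lt_i = 1) //; apply: val_inj.
Qed.

Lemma axis_parallelE L : axis_parallel L ->
  departure L ord0 (across L) = arrival L ord0 (across L) /\
  departure L ord0 (along L) != arrival L ord0 (along L).
Proof.
rewrite /across /along => -[i Li].
have [hor|nhor] := boolP (horizontal L); last first.
  split=> //; apply: (Li); apply: contraNneq nhor => i0.
  by apply/eqP/Li; rewrite -i0.
split; first exact/eqP.
apply: contra_neq (departure_neq_arrival L) => e0.
by apply: row2P => //; exact/eqP.
Qed.

Lemma heading_pm1 L : axis_parallel L -> heading L = 1 \/ heading L = -1.
Proof.
move=> /axis_parallelE[_ ne]; rewrite /heading.
by case: sgzP => [/eqP| |]; [rewrite subr_eq0 eq_sym (negPf ne) | left | right].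
Qed.

Lemma track_across L x : axis_parallel L -> track L x ->
  x ord0 (across L) = departure L ord0 (across L).
Proof.
by move=> /axis_parallelE[e _] [s _ <-]; rewrite !mxE -e; ring.
Qed.

(** On the track, the displacement from the departure point is a nonnegative multiple of the whole
    one, so multiplying by its sign gives the absolute value. *)
Lemma euclidean_dist_track L x : axis_parallel L -> track L x ->
  euclidean_dist (departure L) x =
  (heading L)%:~R * (x ord0 (along L) - departure L ord0 (along L)).
Proof.
move=> Lax Lx; have xacr := track_across Lax Lx.
have -> : euclidean_dist (departure L) x =
    `|x ord0 (along L) - departure L ord0 (along L)|.
  rewrite /euclidean_dist big_ord_recl big_ord1 -sqrtr_sqr; congr Num.sqrt.
  rewrite (_ : lift _ _ = 1); last exact: val_inj.
  move: xacr; rewrite /across /along.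
  by case: (horizontal L) => ->; rewrite subrr; ring.
case: Lx => s; rewrite /= in_itv /= => /andP[s_ge0 _] <-.
rewrite /heading -sgrEz !mxE; set a := departure L _ _; set b := arrival L _ _.
rewrite (_ : _ - a = s * (b - a)); last by ring.
by rewrite normrM (ger0_norm s_ge0) mulrCA -normrEsg.
Qed.

Lemma crossing_perpendicular L K x : axis_parallel L -> axis_parallel K ->
  crossing_point L K x -> horizontal K = ~~ horizontal L.
Proof.
move=> Lax Kax [npar _].
have [same|diff] := eqVneq (horizontal L) (horizontal K); last first.
  by case: (horizontal K) (horizontal L) diff => [] [].
case: npar.
have [eL _] := axis_parallelE Lax; have [eK neK] := axis_parallelE Kax.
move: eL eK neK; rewrite /across /along same.
case: (horizontal K) => eL eK neK.
  exists ((arrival L ord0 0 - departure L ord0 0) /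
          (arrival K ord0 0 - departure K ord0 0)).
  apply: row2P; rewrite !mxE; last by rewrite eL eK !subrr mulr0.
  by rewrite divfK // subr_eq0 eq_sym.
exists ((arrival L ord0 1 - departure L ord0 1) /
        (arrival K ord0 1 - departure K ord0 1)).
apply: row2P; rewrite !mxE; first by rewrite eL eK !subrr mulr0.
by rewrite divfK // subr_eq0 eq_sym.
Qed.

Lemma occupation_disjoint L K x (t u : R) :
  speed L = 1 -> speed K = 1 -> train_length K = train_length L ->
  train_length L <=
    `|(t + euclidean_dist (departure L) x)
      - (u + euclidean_dist (departure K) x)| ->
  occupation L t x `&` occupation K u x = set0.
Proof.
move=> vL vK lK; rewrite /occupation vL vK lK !divr1 => gap.
rewrite -subset0 => _ [[a + <-] [b + eb]].
rewrite !set_itvoo /= => /andP[? ?] /andP[? ?].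
move: gap; rewrite ler_normr => /orP[] ?; lra.
Qed.

Definition phase_delay (l : nat) L : int :=
  ((phase l (horizontal L) (heading L) (height L) + heading L * origin L)
     %% (M l)%:Z)%Z.

(** The [origin L] terms of delay and distance cancel; [k] is minus the quotient dropped by the
    reduction modulo [M l]. *)
Lemma passage_time (l : nat) L x (z : int) : axis_parallel L ->
  integral_point (departure L) -> track L x -> x ord0 (along L) = z%:~R ->
  exists k : int, (phase_delay l L)%:~R + euclidean_dist (departure L) x =
    (phase l (horizontal L) (heading L) (height L) + heading L * z
      + k * (M l)%:Z)%:~R :> R.
Proof.
move=> Lax Lint Lx xz; rewrite (euclidean_dist_track Lax Lx) xz /phase_delay.
set p := phase _ _ _ _; exists (- ((p + heading L * origin L) %/ (M l)%:Z)%Z).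
rewrite -(floorK (Lint (along L))) -/(origin L) -rmorphB -rmorphM -rmorphD /=.
by congr (_%:~R); rewrite /modz; ring.
Qed.

Lemma crossing_gap (l : nat) L K x : (0 < l)%N ->
  axis_parallel L -> axis_parallel K ->
  integral_point (departure L) -> integral_point (departure K) ->
  horizontal L -> crossing_point L K x ->
  l%:R <= `|((phase_delay l L)%:~R + euclidean_dist (departure L) x)
            - ((phase_delay l K)%:~R + euclidean_dist (departure K) x)| :> R.
Proof.
move=> l_gt0 Lax Kax Lint Kint hL LKx.
have hK : horizontal K = false.
  by rewrite (crossing_perpendicular Lax Kax LKx) hL.
have [_ [Lx Kx]] := LKx.
(* The position of the crossing point along one track is the transversal coordinate of the other,
   hence an integer. *)
have xL : x ord0 (along L) = (height K)%:~R.
  rewrite /height floorK // -(track_across Kax Kx).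
  by rewrite /along /across hL hK.
have xK : x ord0 (along K) = (height L)%:~R.
  rewrite /height floorK // -(track_across Lax Lx).
  by rewrite /along /across hL hK.
have [k ->] := passage_time l Lax Lint Lx xL.
have [m ->] := passage_time l Kax Kint Kx xK.
rewrite -rmorphB -intr_norm pmulrn ler_int hL hK.
have := phase_gap (height K) (height L) (k - m) l_gt0
  (heading_pm1 Lax) (heading_pm1 Kax).
rewrite mulrBl; lia.
Qed.

End PhaseDelay.

Theorem theorem3p2 (R : realType) (l : nat) (hl : (1 <= l)%N)
    (N : set (train_line R 2)) (hN : train_network N) (hreg : regular N)
    (hlen : trains_of_length N l%:R) :
  exists t : train_line R 2 -> R,
    schedule N t /\ (delay N t <= ((M l)%:R - 1)%:E)%E.
Proof.
have [hspeed _ hax hint] := hreg.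
have M_gt0 : 0 < (M l)%:Z :> int.
  by rewrite /M; case: ifP => //; case: ifP; lia.
have delay_ge0 L : 0 <= phase_delay l L by apply: modz_ge0; lia.
exists (fun L => (phase_delay l L)%:~R); split; [split|].
- by move=> L _; rewrite ler0z.
- move=> L K x NL NK LKx.
  have [[Lint _] [Kint _]] := (hint _ NL, hint _ NK).
  have [Lax Kax] := (hax _ NL, hax _ NK).
  apply: occupation_disjoint; rewrite ?hspeed ?hlen //.
  have [hL|hL] := boolP (horizontal L); first exact: crossing_gap.
  rewrite distrC; apply: crossing_gap => //.
    by rewrite (crossing_perpendicular Lax Kax LKx).
  (* Swapping the lines inverts the ratio [c], nonzero because the endpoints of [K] differ. *)
  have [npar [Lx Kx]] := LKx; split=> // -[c e]; apply: npar; exists c^-1.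
  have c_neq0 : c != 0.
    apply: contra_neq (departure_neq_arrival K) => c0.
    by apply/esym/eqP; rewrite -subr_eq0 e c0 scale0r.
  by rewrite e scalerA mulVf // scale1r.
(* The adjoined 0 needs [1 <= M l]; the delays are residues modulo [M l]. *)
- apply: ge_ereal_sup => _ [->|[L _ <-]]; rewrite lee_fin.
    by rewrite subr_ge0 ler1n; lia.
  have -> : (M l)%:R - 1 = ((M l)%:Z - 1)%:~R :> R by rewrite rmorphB.
  rewrite ler_int.
  have := ltz_pmod (phase l (horizontal L) (heading L) (height L)
    + heading L * origin L) M_gt0.
  by rewrite -/(phase_delay l L); lia.
Qed.
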